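(* Let $G$ be a linearly ordered group. Let $(S,P)$ be either $(\mathscr{B}(G),G)$ or $(\mathscr{B}^+(G),G^+)$, so that $S=\{\alpha^g_h: g,h\in P\}$. Then the following assertions hold. (i) If $\alpha^g_g,\alpha^h_h\in E(S)$, then $\alpha^g_g\preccurlyeq\alpha^h_h$ if and only if $g\geqslant h$ in $P$. (ii) The semilattice $E(S)$ is isomorphic to $P$, considered as a $\vee$-semilattice, under the mapping $(\alpha^g_g)\mathfrak{i}=g$. (iii) $\alpha^g_h\mathscr{R}\alpha^k_l$ in $S$ if and only if $g=k$. (iv) $\alpha^g_h\mathscr{L}\alpha^k_l$ in $S$ if and only if $h=l$. (v) $\alpha^g_h\mathscr{H}\alpha^k_l$ in $S$ if and only if $g=k$ and $h=l$, and hence every $\mathscr{H}$-class in $S$ is a singleton set. (vi) $\alpha^g_h\mathscr{D}\alpha^k_l$ in $S$ for all $g,h,k,l\in P$, and hence $S$ is a bisimple semigroup. (vii) $S$ is a simple semigroup.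
   Context: A linearly ordered group is a group $G$ (identity $e$) with a total order $\leqslant$ such that $a\leqslant b$ implies $ag\leqslant bg$ and $ga\leqslant gb$ for all $a,b,g\in G$; $G^+=\{x\in G: e\leqslant x\}$; $\vee$ denotes maximum. For $g,h\in G$, $\alpha^g_h$ is the partial map $G\rightharpoonup G$ with domain $G^+(g)=\{x\in G: g\leqslant x\}$ given by $(x)\alpha^g_h=x g^{-1}h$. Put $\mathscr{B}(G)=\{\alpha^g_h: g,h\in G\}$ and $\mathscr{B}^+(G)=\{\alpha^g_h: g,h\in G^+\}$; these are semigroups under composition of partial maps (maps written on the right, $x(\alpha\beta)=(x\alpha)\beta$ for $x\in\operatorname{dom}\alpha$ with $x\alpha\in\operatorname{dom}\beta$); explicitly $\alpha^g_h\cdot\alpha^k_l=\alpha^a_b$ with $a=(h\vee k)h^{-1}g$, $b=(h\vee k)k^{-1}l$. They are inverse semigroups whose idempotents are exactly the elements $\alpha^g_g$. $E(S)$ is the set of idempotents of $S$, with natural partial order $\varepsilon\preccurlyeq\iota$ iff $\varepsilon\iota=\iota\varepsilon=\varepsilon$. $\mathscr{R},\mathscr{L},\mathscr{H},\mathscr{D},\mathscr{J}$ are Green's relations ($a\mathscr{R}b$ iff $aS^1=bS^1$; $a\mathscr{L}b$ iff $S^1a=S^1b$; $\mathscr{H}=\mathscr{L}\cap\mathscr{R}$; $\mathscr{D}=\mathscr{L}\circ\mathscr{R}$; $a\mathscr{J}b$ iff $S^1aS^1=S^1bS^1$). Bisimple means having a single $\mathscr{D}$-class; simple means having a single $\mathscr{J}$-class.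 *)

(* Defs.v *)
From HB Require Import structures.
From mathcomp Require Import all_boot all_order.
From mathcomp Require Import boolp classical_sets functions.

Set Implicit Arguments.
Unset Strict Implicit.
Unset Printing Implicit Defensive.

Import Order.TTheory.

Local Open Scope classical_set_scope.
Local Open Scope order_scope.
Local Open Scope group_scope.

HB.mixin Record isLinearlyOrderedGroup (d : Order.disp_t) G
    of Group G & Order.Total d G := {
  lomul2r : forall a b g : G, a <= b -> a * g <= b * g;
  lomul2l : forall a b g : G, a <= b -> g * a <= g * b
}.

#[short(type="loGroupType")]
HB.structure Definition LinearlyOrderedGroup (d : Order.disp_t) :=
  {G of isLinearlyOrderedGroup d G & Group G & Order.Total d G}.

Definition positive_cone d (G : loGroupType d) : set G := [set x | 1 <= x].

Section SubsemigroupTheory.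
Variable T : semigroupType.
Implicit Types (S : set T) (a b e f : T).

(* The notions below are those of the semigroup S, where S is a subsemigroup
   of an ambient semigroup T: all witnesses range over S only. *)

Definition subsemigroup S :=
  S !=set0 /\ forall a b, S a -> S b -> S (a * b).

Definition idempotents S : set T := [set e | S e /\ e * e = e].

Definition natural_le e f := e * f = e /\ f * e = e.

(* a S^1 = {a} U aS, S^1 a = {a} U Sa, and S^1 a S^1; these sets are the same
   whether or not an identity had to be adjoined to form S^1. *)
Definition right_ideal S a : set T := [set a] `|` [set a * s | s in S].
Definition left_ideal S a : set T := [set a] `|` [set s * a | s in S].
Definition ideal S a : set T :=
  \bigcup_(x in left_ideal S a) right_ideal S x.

Definition greenR S a b := right_ideal S a = right_ideal S b.
Definition greenL S a b := left_ideal S a = left_ideal S b.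
Definition greenH S a b := greenL S a b /\ greenR S a b.
Definition greenD S a b := exists c, [/\ S c, greenL S a c & greenR S c b].
Definition greenJ S a b := ideal S a = ideal S b.

Definition greenH_class S a : set T := [set b | S b /\ greenH S a b].

Definition bisimple S :=
  subsemigroup S /\ forall a b, S a -> S b -> greenD S a b.

Definition simple S :=
  subsemigroup S /\ forall a b, S a -> S b -> greenJ S a b.

Definition subsemilattice (E : set T) :=
  [/\ subsemigroup E, {in E, forall e, e * e = e} & {in E &, commutative *%g}].

End SubsemigroupTheory.

(* Partial maps T -> T, with None for "undefined". They act on the right, so
   that a * b is "first a, then b". *)
Definition partial_map (T : Type) : Type := T -> option T.

Section PartialMapSemigroup.
Variable T : choiceType.

HB.instance Definition _ := Choice.copy (partial_map T) (T -> option T).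

Definition partial_map_mul (a b : partial_map T) : partial_map T := pcomp b a.

Fact partial_map_mulA : associative partial_map_mul.
Proof.
move=> a b c; apply: funext => x; rewrite /partial_map_mul /pcomp.
by case: (a x).
Qed.

HB.instance Definition _ :=
  isSemigroup.Build (partial_map T) partial_map_mulA.

End PartialMapSemigroup.

Section Alpha.
Variables (d : Order.disp_t) (G : loGroupType d).

Definition alpha (g h : G) : partial_map G :=
  fun x => if g <= x then Some (x * g^-1 * h) else None.

(* B(G) for P = G, and B^+(G) for P the positive cone *)
Definition alphas (P : set G) : set (partial_map G) :=
  [set a | exists g h, [/\ P g, P h & a = alpha g h]].

Lemma alpha_mul (g h k l : G) :
  alpha g h * alpha k l =
  alpha (Order.max h k * h^-1 * g) (Order.max h k * k^-1 * l).
Proof.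
apply: funext => x; rewrite /alpha [LHS]/(obind _ _) /=.
have shift (a b c : G) : (a * b <= c) = (a <= c * b^-1).
  by apply/idP/idP => [/(lomul2r _ _ b^-1)|/(lomul2r _ _ b)]; rewrite ?mulgK ?mulgVK.
have -> : (Order.max h k * h^-1 * g <= x) = (Order.max h k <= x * g^-1 * h).
  by rewrite !shift invgK.
rewrite ge_max.
have -> : (h <= x * g^-1 * h) = (g <= x).
  by rewrite -[X in X <= _]mul1g !shift mulgK -shift mul1g.
case: ifP => //= _; case: ifP => //= _; congr Some.
by rewrite !invgM invgK !mulgA mulgVK.
Qed.

Lemma alphas_subsemigroup (P : set G) :
  P = setT \/ P = @positive_cone d G -> subsemigroup (alphas P).
Proof.
have up (a b g : G) : g <= Order.max a b * a^-1 * g.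
  rewrite -[X in X <= _]mul1g; apply: lomul2r.
  by rewrite -(mulgV a); apply: lomul2r; rewrite le_max lexx.
move=> PE; split=> [|a b [g [h [Pg Ph ->]]] [k [l [Pk Pl ->]]]].
  have P1 : P 1 by case: PE => ->; rewrite /positive_cone //=.
  by exists (alpha 1 1), 1, 1.
rewrite alpha_mul; do 2!eexists; split; [| |by []].
  by case: PE Pg => -> //= /le_trans; apply; apply: up.
by case: PE Pl => -> //= /le_trans; apply; rewrite maxC; apply: up.
Qed.

End Alpha.

(* Main.v *)
(* The product rule gives [alpha g h * alpha h l = alpha g l], so [alpha g h] and
   [alpha k l] generate the same right (left, two-sided) ideals as soon as
   [g = k] ([h = l], always).  Conversely, right multiples of [alpha k l] have a
   smaller domain and left multiples a smaller image; as [g] is the least element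
   of the domain of [alpha g h] and [h] that of its image, these elements can be
   read off the ideals.  On idempotents the product is the maximum. *)
Require Import Defs.
From HB Require Import structures.
From mathcomp Require Import all_boot all_order.
From mathcomp Require Import boolp classical_sets functions.

Local Open Scope classical_set_scope.
Local Open Scope order_scope.
Local Open Scope group_scope.

Import Order.TTheory.

Section AlphaTheory.
Variables (d : Order.disp_t) (G : loGroupType d).
Implicit Types (g h k l x y : G) (P : set G).

Lemma alpha_least g h : alpha g h g = Some h.
Proof. by rewrite /alpha lexx mulgV mul1g. Qed.

Lemma alpha_domain g h x y : alpha g h x = Some y -> g <= x.
Proof. by rewrite /alpha; case: ifP. Qed.

Lemma alpha_image g h x y : alpha g h x = Some y -> h <= y.
Proof.
rewrite /alpha; case: ifP => // gx [<-].
(* From [g <= x] comes [1 <= x * g^-1]; right multiplication by [h] then bounds the value below by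
   [h]. *)
rewrite -[X in X <= _]mul1g; apply: lomul2r.
by rewrite -(mulgV g); apply: lomul2r.
Qed.

Lemma alpha_inj g h k l : alpha g h = alpha k l -> g = k /\ h = l.
Proof.
move=> E.
have gk : g = k.
  (* As the maps agree, [g] lies in the domain of [alpha k l] and [k] in that of [alpha g h]. *)
  apply/le_anti/andP; split.
    by apply: (alpha_domain g h k l); rewrite E alpha_least.
  by apply: (alpha_domain k l g h); rewrite -E alpha_least.
by split=> //; move: (alpha_least g h); rewrite E gk alpha_least => -[].
Qed.

Lemma alpha_mul_cancel g h l : alpha g h * alpha h l = alpha g l.
Proof. by rewrite alpha_mul maxxx mulgV !mul1g. Qed.

Lemma alpha_mul_diag g h :
  alpha g g * alpha h h = alpha (Order.max g h) (Order.max g h).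
Proof. by rewrite alpha_mul !mulgVK. Qed.

Lemma partial_map_mulE (a b : partial_map G) x : (a * b) x = obind b (a x).
Proof. by []. Qed.

Lemma mem_alphas P g h : P g -> P h -> alphas P (alpha g h).
Proof. by move=> Pg Ph; exists g, h. Qed.

(** A multiple [alpha k l * s] is defined only where [alpha k l] is. Evaluating at [g], where
    [alpha g h] is defined, puts [g] in the domain of [alpha k l]. *)
Lemma right_ideal_alpha_le (S : set (partial_map G)) g h k l :
  right_ideal S (alpha k l) (alpha g h) -> k <= g.
Proof.
case=> [/alpha_inj[-> _] //|[s _ /(congr1 (@^~ g))]].
rewrite alpha_least partial_map_mulE.
by case E: (alpha k l g) => [y|] // _; apply: alpha_domain E.
Qed.

(** Evaluation at [g] gives [h], and every value of [s * alpha k l] is a value of [alpha k l], hence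
    at least [l]. *)
Lemma left_ideal_alpha_le (S : set (partial_map G)) g h k l :
  left_ideal S (alpha k l) (alpha g h) -> l <= h.
Proof.
case=> [/alpha_inj[_ ->] //|[s _ /(congr1 (@^~ g))]].
rewrite alpha_least partial_map_mulE.
by case: (s g) => //= y /alpha_image.
Qed.

(** The generator factors as [alpha g h = alpha g l * alpha l h], and the second factor can be
    absorbed into any further multiplier from [alphas P]. *)
Lemma right_ideal_alpha_sub P g h l : subsemigroup (alphas P) ->
  P h -> P l ->
  right_ideal (alphas P) (alpha g h) `<=` right_ideal (alphas P) (alpha g l).
Proof.
move=> [_ SM] Ph Pl _ [->|[s Ss <-]]; right.
  by exists (alpha l h); [apply: mem_alphas | apply: alpha_mul_cancel].
exists (alpha l h * s); first by apply: SM => //; apply: mem_alphas.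
by rewrite mulgA alpha_mul_cancel.
Qed.

Lemma left_ideal_alpha_sub P g k h : subsemigroup (alphas P) ->
  P g -> P k ->
  left_ideal (alphas P) (alpha g h) `<=` left_ideal (alphas P) (alpha k h).
Proof.
move=> [_ SM] Pg Pk _ [->|[s Ss <-]]; right.
  by exists (alpha g k); [apply: mem_alphas | apply: alpha_mul_cancel].
exists (s * alpha g k); first by apply: SM => //; apply: mem_alphas.
by rewrite -mulgA alpha_mul_cancel.
Qed.

Lemma greenR_alpha P g h k l : subsemigroup (alphas P) -> P h -> P l ->
  greenR (alphas P) (alpha g h) (alpha k l) <-> g = k.
Proof.
move=> SS Ph Pl; split=> [E|->].
  apply/le_anti/andP; split.
    by apply: (right_ideal_alpha_le (alphas P) k l g h); rewrite E; left.
  by apply: (right_ideal_alpha_le (alphas P) g h k l); rewrite -E; left.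
by apply/seteqP; split; apply: right_ideal_alpha_sub.
Qed.

Lemma greenL_alpha P g h k l : subsemigroup (alphas P) -> P g -> P k ->
  greenL (alphas P) (alpha g h) (alpha k l) <-> h = l.
Proof.
move=> SS Pg Pk; split=> [E|->].
  apply/le_anti/andP; split.
    by apply: (left_ideal_alpha_le (alphas P) k l g h); rewrite E; left.
  by apply: (left_ideal_alpha_le (alphas P) g h k l); rewrite -E; left.
by apply/seteqP; split; apply: left_ideal_alpha_sub.
Qed.

Lemma greenH_alpha P g h k l : subsemigroup (alphas P) ->
  P g -> P h -> P k -> P l ->
  greenH (alphas P) (alpha g h) (alpha k l) <-> g = k /\ h = l.
Proof.
move=> SS Pg Ph Pk Pl.
have RE := greenR_alpha P g h k l SS Ph Pl.
have LE := greenL_alpha P g h k l SS Pg Pk.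
by split=> [[/LE ? /RE ?]|[/RE ? /LE ?]].
Qed.

Lemma greenD_alpha P g h k l : subsemigroup (alphas P) ->
  P g -> P h -> P k -> P l ->
  greenD (alphas P) (alpha g h) (alpha k l).
Proof.
(* The witness takes its second index from [alpha g h] and its first from [alpha k l]. *)
move=> SS Pg Ph Pk Pl; exists (alpha k h); split; first exact: mem_alphas.
  exact/greenL_alpha.
exact/greenR_alpha.
Qed.

(** Any [alpha k l] is reached from [alpha g h] as [alpha k g * alpha g h * alpha h l], so a single
    element generates everything. *)
Lemma ideal_alphas P (a : partial_map G) : subsemigroup (alphas P) -> alphas P a ->
  ideal (alphas P) a = alphas P.
Proof.
move=> [_ SM] Sa; apply/seteqP; split=> [b [c]|].
  have SL s : left_ideal (alphas P) a s -> alphas P s.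
    by case=> [->|[t St <-]] //; apply: SM.
  by move=> /SL Sc [->|[s Ss <-]] //; apply: SM.
case: Sa => g [h [Pg Ph ->]] _ [k [l [Pk Pl ->]]].
exists (alpha k h); right.
  by exists (alpha k g); [apply: mem_alphas | apply: alpha_mul_cancel].
by exists (alpha h l); [apply: mem_alphas | apply: alpha_mul_cancel].
Qed.

Lemma idempotents_alphaP P (e : partial_map G) :
  idempotents (alphas P) e <-> exists2 g, P g & e = alpha g g.
Proof.
split=> [[[g [h [Pg Ph ->]]]]|[g Pg ->]]; last first.
  by split; [apply: mem_alphas | apply: alpha_mul_cancel].
(* Comparing indices in the square of [alpha g h] and cancelling shows that [Order.max h g] equals
   both [h] and [g]. *)
rewrite alpha_mul => /alpha_inj[/(canRL (mulgK _)) + /(canRL (mulgK _))].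
rewrite !mulgV => /(canRL (mulgVK _)) + /(canRL (mulgVK _)).
by rewrite !mul1g => -> ->; exists g.
Qed.

Lemma natural_le_alpha g h : natural_le (alpha g g) (alpha h h) <-> h <= g.
Proof.
rewrite /natural_le !alpha_mul_diag (maxC h); split=> [[/alpha_inj[gh _] _]|hg].
  by rewrite -gh le_max lexx orbT.
by rewrite max_l.
Qed.

(** The isomorphism has to be total on partial maps; the default [1] is taken only off the maps
    [alpha g g], on which injectivity of [alpha] makes the choice unique. *)
Definition idempotent_index (e : partial_map G) : G :=
  xget 1 [set g | e = alpha g g].

Lemma idempotent_indexK g : idempotent_index (alpha g g) = g.
Proof. by apply: xget_unique => // h /alpha_inj[]. Qed.

End AlphaTheory.

Theorem proposition2p1 (d : Order.disp_t) (G : loGroupType d) (P : set G)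
    (PE : P = setT \/ P = @positive_cone d G) :
  let S := alphas P in
  let E := idempotents S in
  (* (i) *)
  (forall g h : G, P g -> P h -> E (alpha g g) -> E (alpha h h) ->
     (natural_le (alpha g g) (alpha h h) <-> g >= h)) /\
  (* (ii) *)
  (subsemilattice E /\
   exists i : partial_map G -> G,
     [/\ forall g : G, P g -> E (alpha g g) /\ i (alpha g g) = g,
         set_bij E P i &
         {in E &, {morph i : e f / e * f >-> Order.max e f}}]) /\
  (* (iii) *)
  (forall g h k l : G, P g -> P h -> P k -> P l ->
     (greenR S (alpha g h) (alpha k l) <-> g = k)) /\
  (* (iv) *)
  (forall g h k l : G, P g -> P h -> P k -> P l ->
     (greenL S (alpha g h) (alpha k l) <-> h = l)) /\
  (* (v) *)
  ((forall g h k l : G, P g -> P h -> P k -> P l ->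
      (greenH S (alpha g h) (alpha k l) <-> g = k /\ h = l)) /\
   (forall a, S a -> greenH_class S a = [set a])) /\
  (* (vi) *)
  ((forall g h k l : G, P g -> P h -> P k -> P l ->
      greenD S (alpha g h) (alpha k l)) /\
   bisimple S) /\
  (* (vii) *)
  simple S.
Proof.
have SS := alphas_subsemigroup PE.
have Pmax g h : P g -> P h -> P (Order.max g h) by rewrite maxEle; case: ifP.
move=> S E.
have EE g : P g -> E (alpha g g) by move=> Pg; apply/idempotents_alphaP; exists g.
have EM g h : P g -> P h -> E (alpha g g * alpha h h).
  by move=> Pg Ph; rewrite alpha_mul_diag; apply/EE/Pmax.
split; first by move=> g h _ _ _ _; apply: natural_le_alpha.
split.
  split.
    split.
    - split.
        (* Nonemptiness of [S] supplies an index in [P], hence an idempotent. *)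
        case: SS => [[_ [g [_ [Pg _ _]]]] _].
        by exists (alpha g g); apply: EE.
      move=> _ _ /idempotents_alphaP[g Pg ->] /idempotents_alphaP[h Ph ->].
      exact: EM.
    - by move=> e; rewrite inE => -[].
    - move=> e f; rewrite !inE.
      move=> /idempotents_alphaP[g _ ->] /idempotents_alphaP[h _ ->].
      by rewrite !alpha_mul_diag maxC.
  exists (idempotent_index d G); split.
  - by move=> g Pg; split; [apply: EE | apply: idempotent_indexK].
  - split.
    + by move=> _ /idempotents_alphaP[g Pg ->]; rewrite idempotent_indexK.
    + move=> e f; rewrite !inE.
      move=> /idempotents_alphaP[g _ ->] /idempotents_alphaP[h _ ->].
      by rewrite !idempotent_indexK => ->.
    + by move=> g Pg; exists (alpha g g); [apply: EE | apply: idempotent_indexK].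
  - move=> e f; rewrite !inE.
    move=> /idempotents_alphaP[g _ ->] /idempotents_alphaP[h _ ->].
    by rewrite alpha_mul_diag !idempotent_indexK.
split; first by move=> *; apply: greenR_alpha.
split; first by move=> *; apply: greenL_alpha.
split.
  split; first by move=> *; apply: greenH_alpha.
  move=> _ [g [h [Pg Ph ->]]]; apply/seteqP; split.
    by move=> _ [[k [l [Pk Pl ->]]] /greenH_alpha[] // -> ->].
  by move=> _ ->; split; [apply: mem_alphas | split].
split.
  split; first by move=> *; apply: greenD_alpha.
  split=> // _ _ [g [h [Pg Ph ->]]] [k [l [Pk Pl ->]]].
  exact: greenD_alpha.
(* Both principal ideals are all of [S]. *)
by split=> // a b Sa Sb; rewrite /greenJ !ideal_alphas.
Qed.
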